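(* For nonnegative integers $n$ and $k$, $$\left|\mathcal{T}_{n,k}\right| = \sum_{m=k}^n \binom{n+1}{m+1} S(m+1,k+1)\, k!\, (n-k)^{n-m-1} (m-k),$$ where $S(a,b)$ denotes the Stirling number of the second kind.
   Context: For a nonnegative integer $n$, let $\mathcal{T}_n$ be the set of rooted labeled trees on the vertex set $[0,n]=\{0,1,\dots,n\}$. For $T\in\mathcal{T}_n$, the maximal decreasing subtree $\mathrm{MD}(T)$ is the subtree of $T$ induced by the root together with all vertices $v$ such that the labels strictly decrease along the path from the root to $v$ (i.e. the maximal subtree containing the root in which every edge goes from a larger label (parent) to a smaller label (child)). Let $\mathcal{T}_{n,k}$ be the set of $T\in\mathcal{T}_n$ such that $\mathrm{MD}(T)$ has exactly $k+1$ vertices. In the sum, the factor $(n-k)^{n-m-1}(m-k)$ (the number of rooted forests on $n-k$ labeled vertices with a prescribed set of $m-k$ roots) is interpreted as $1$ when $m=n$. *)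

(* Defs.v *)
From mathcomp Require Import all_boot.

Set Implicit Arguments.
Unset Strict Implicit.
Unset Printing Implicit Defensive.

Section Graphs.
Variable V : finType.
Implicit Types (E : {set {set V}}) (x y : V) (p s : seq V).

(* A simple graph on V is given by its edge set, a set of 2-element sets. *)
Definition simple_graph E : bool := [forall e in E, #|e| == 2].

Definition adj E : rel V := fun x y => [set x; y] \in E.

Definition connected_graph E : bool :=
  [forall x, forall y, connect (adj E) x y].

(* The vertices of a cycle are distinct, so length at most #|V| is no
   restriction; it only makes the quantifier range over a finite type. *)
Definition acyclic_graph E : bool :=
  ~~ [exists s : #|V|.-bseq V,
        [&& 2 < size s, uniq s & cycle (adj E) s]].

Definition is_tree E : bool :=
  [&& simple_graph E, connected_graph E & acyclic_graph E].

(* x :: p is a simple path of E from x to y. *)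
Definition simple_path E x y p : bool :=
  [&& path (adj E) x p, uniq (x :: p) & last x p == y].

End Graphs.

(* A rooted tree is a pair of an edge set and a root. *)
Definition rooted_trees (n : nat) :
    {set {set {set 'I_n.+1}} * 'I_n.+1} :=
  [set T | is_tree T.1].

(* A simple path in 'I_n.+1 has at most n vertices besides its start, so the
   bound n on the size of p is no restriction. *)
Definition MD (n : nat) (T : {set {set 'I_n.+1}} * 'I_n.+1) : {set 'I_n.+1} :=
  [set v | [exists p : n.-bseq 'I_n.+1,
     simple_path T.1 T.2 v p
       && path (fun x y : 'I_n.+1 => y < x) T.2 p]].

Definition rooted_trees_MD (n k : nat) :
    {set {set {set 'I_n.+1}} * 'I_n.+1} :=
  [set T in rooted_trees n | #|MD T| == k.+1].

Definition stirling2 (a b : nat) : nat :=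
  #|[set P : {set {set 'I_a}} | partition P [set: 'I_a] & #|P| == b]|.

(* (n - k)^(n - m - 1) (m - k), read as 1 when m = n, where the exponent
   would be -1. For k <= m < n no subtraction is truncated. *)
Definition forest_factor (n k m : nat) : nat :=
  if m == n then 1 else (n - k) ^ (n - m - 1) * (m - k).

(* Main.v *)
Require Import Defs.
From mathcomp Require Import all_boot zify ring.

(* A rooted tree is the same as a parent map f with f r = r and no nonempty set
   of non-root vertices stable under f.  Let D be the vertex set of the maximal
   decreasing subtree and A = f^-1(D), that is, D together with all children of
   vertices of D.  For fixed D and A of sizes k+1 and m+1, the map f splits into
   three independent parts: on D it is a decreasing tree (k! choices), on A \ D
   it selects a smaller element of D, and on the complement of A it is a forest
   with root set A \ D, of which there are (m-k)(n-k)^(n-m-1).  Summing the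
   second factor over D inside A counts the partitions of A into k+1 blocks,
   because such a partition is given by its block minima D and by the map that
   sends every other point to the minimum of its block. *)

Set Implicit Arguments.
Unset Strict Implicit.
Unset Printing Implicit Defensive.

(** * Forests with prescribed roots *)

Section Forests.
Variable T : finType.
Implicit Types (W R A B X : {set T}) (f : T -> T) (O : T -> {set T}).

(* Iterating f leads from every point of W out of W. *)
Definition acyc W f : bool :=
  [forall X : {set T}, (X \subset W) && (X != set0) ==> ~~ (f @: X \subset X)].

Lemma acycP W f :
  reflect (forall X, X \subset W -> (forall x, x \in X -> f x \in X) -> X = set0)
          (acyc W f).
Proof.
apply: (iffP forallP) => [acW X sXW clX | acW X].
  apply/eqP/negPn/negP => X0; have := acW X; rewrite sXW X0 /= => /negP; case.
  by apply/subsetP => _ /imsetP[x xX ->]; apply: clX.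
apply/implyP => /andP[sXW X0]; apply: contra X0 => clX; apply/eqP/acW => // x xX.
by apply: (subsetP clX); apply: imset_f.
Qed.

Lemma eq_in_acyc W f g : {in W, f =1 g} -> acyc W f = acyc W g.
Proof.
move=> efg; apply/acycP/acycP => ac X sX cl; apply: ac => // x xX;
  have xW := subsetP sX x xX.
  by rewrite efg // cl.
by rewrite -efg // cl.
Qed.

Lemma acycS W B f : B \subset W -> acyc W f -> acyc B f.
Proof.
move=> sBW /acycP ac; apply/acycP => X sX; apply: ac; exact: subset_trans sBW.
Qed.

(** Points of [B] leave [W] in one step, so a stable subset of [W] cannot meet [B]. *)
Lemma acyc_setD W B f :
  {in B, forall x, f x \notin W} -> acyc (W :\: B) f -> acyc W f.
Proof.
move=> outB /acycP ac; apply/acycP => X sX cl; apply: (ac) => //.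
rewrite subsetD sX; apply/pred0P => x /=; apply/negP => /andP[xX xB].
by move/negP: (outB x xB); apply; apply: (subsetP sX); apply: cl.
Qed.

Lemma disjointDr A B : [disjoint A & B :\: A].
Proof. by apply/pred0P => x /=; rewrite in_setD; case: (x \in A). Qed.

(* Off A such a map is the identity, so that it is determined by its values on A. *)
Definition maps A O : {set {ffun T -> T}} :=
  [set f : {ffun T -> T} | [forall v, f v \in if v \in A then O v else [set v]]].

Lemma mapsP A O (f : {ffun T -> T}) :
  reflect (forall v, f v \in if v \in A then O v else [set v]) (f \in maps A O).
Proof. by rewrite inE; apply: forallP. Qed.

Lemma card_maps A O : #|maps A O| = \prod_(v in A) #|O v|.
Proof.
pose F v := if v \in A then O v else [set v].
have -> : #|maps A O| = #|(family F : pred {ffun T -> T})|.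
  by apply: eq_card => f; apply/mapsP/familyP.
rewrite card_family foldrE big_map big_enum /= [RHS]big_mkcond /=.
by apply: eq_bigr => v _; rewrite /F; case: ifP; rewrite ?cards1.
Qed.

(** Acyclicity on [B] depends only on the values on [B], so the choices on [A] are free; [h] glues
    the two independent parts. *)
Lemma card_maps_acyc A B O : [disjoint A & B] ->
  #|[set f in maps (A :|: B) O | acyc B f]| =
  \prod_(v in A) #|O v| * #|[set f in maps B O | acyc B f]|.
Proof.
move=> dAB; rewrite -card_maps -cardsX.
pose h (p : {ffun T -> T} * {ffun T -> T}) : {ffun T -> T} :=
  [ffun v => if v \in A then p.1 v else p.2 v].
have BA v : v \in B -> v \in A = false by move=> vB; apply: (disjointFl dAB).
rewrite -(card_in_imset (f := h)); last first.
  move=> [f1 f2] [g1 g2] /setXP[/= /mapsP m1 /setIdP[/mapsP m2 _]].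
  move=> /setXP[/= /mapsP n1 /setIdP[/mapsP n2 _]] /ffunP eh.
  have e v : f1 v = g1 v /\ f2 v = g2 v.
    move: (eh v) (m1 v) (m2 v) (n1 v) (n2 v); rewrite !ffunE /=.
    case: ifP => vA; last by move=> -> /set1P -> _ /set1P -> _.
    by rewrite (disjointFr dAB vA) => -> _ /set1P -> _ /set1P ->.
  by congr pair; apply/ffunP => v; have [] := e v.
apply: eq_card => f; apply/idP/imsetP => [/setIdP[/mapsP m ac]|].
  exists ([ffun v => if v \in A then f v else v],
          [ffun v => if v \in B then f v else v]); last first.
    apply/ffunP => v; rewrite !ffunE /=; move: (m v); rewrite in_setU.
    by case: (v \in A); case: (v \in B) => //= /set1P ->.
  apply/setXP; split=> /=; last apply/setIdP; first 1 [idtac] || split.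
  - apply/mapsP => v; rewrite ffunE; move: (m v); rewrite in_setU.
    by case: (v \in A) => //=; rewrite set11.
  - apply/mapsP => v; rewrite ffunE; move: (m v); rewrite in_setU.
    by case: (v \in B) => //=; rewrite ?orbT ?set11.
  - by rewrite (eq_in_acyc (g := f)) // => v vB; rewrite ffunE vB.
case=> [[f1 f2]] /setXP[/= /mapsP m1 /setIdP[/mapsP m2 ac]] ->.
apply/setIdP; split.
  apply/mapsP => v; rewrite ffunE /= in_setU; move: (m1 v) (m2 v).
  by case: ifP.
by rewrite (eq_in_acyc (g := f2)) // => v vB; rewrite ffunE BA.
Qed.

(** For disjoint [W] and [R]: forests with root set [R] and non-root vertices [W], encoded by their
    parent maps. *)
Definition forests W R : {set {ffun T -> T}} :=
  [set f in maps W (fun=> W :|: R) | acyc W f].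

(** Generalized Cayley formula. The case [w = 0] is separate because the truncated exponent would
    give [r] instead of 1. *)
Definition forest_count (w r : nat) : nat :=
  if w == 0 then 1 else r * (w + r) ^ w.-1.

Lemma forests_no_root W : W != set0 -> forests W set0 = set0.
Proof.
move=> W0; apply/setP => f; rewrite [RHS]inE; apply/negP => /setIdP[/mapsP m].
move/acycP => /(_ W (subxx _)) ac; case/negP: W0; apply/eqP; apply: ac => v vW.
by move: (m v); rewrite vW setU0.
Qed.

(** [S] is the set of children of roots. Each point of [S] chooses its parent freely in [R], and
    deleting [R] leaves a forest on [W :\: S] rooted at [S]. *)
Lemma card_forests_by_children W R : [disjoint W & R] ->
  #|forests W R| =
  \sum_(S : {set T} | S \subset W) #|R| ^ #|S| * #|forests (W :\: S) S|.
Proof.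
move=> dWR.
pose q (f : {ffun T -> T}) := [set v in W | f v \in R].
rewrite -sum1_card (partition_big q (fun S => S \subset W)) /=; last first.
  by move=> f _; apply/subsetP => v /setIdP[].
apply: eq_bigr => S sSW; rewrite sum1_card.
have WE : W = S :|: W :\: S.
  by rewrite setDE setUIr setUCr setIT; apply/esym/setUidPr.
pose O v := if v \in S then R else W.
have -> : #|R| ^ #|S| = \prod_(v in S) #|O v|.
  by rewrite -prod_nat_const; apply: eq_bigr => v; rewrite /O => ->.
have -> : forests (W :\: S) S = [set f in maps (W :\: S) O | acyc (W :\: S) f].
  apply/setP => f; rewrite /forests !in_set; congr andb; apply: eq_forallb => v.
  case: ifP => //; rewrite /O in_setD => /andP[/negPf-> _].
  by rewrite setUC -WE.
rewrite -card_maps_acyc; last exact: disjointDr.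
apply: eq_card => f; rewrite unfold_in -WE; apply/andP/setIdP.
  case=> /setIdP[/mapsP m ac] /eqP qf; split; last by apply: acycS ac; apply: subsetDl.
  apply/mapsP => v; move: (m v); case: ifP => // vW.
  have -> : O v = if f v \in R then R else W by rewrite /O -qf inE vW.
  by rewrite in_setU; case: ifP => //; rewrite orbF.
case=> /mapsP m ac; split.
  apply/setIdP; split.
    apply/mapsP => v; move: (m v); case: ifP => // _; rewrite /O in_setU.
    by case: ifP => _ ->; rewrite ?orbT.
  apply: acyc_setD ac => x xS; move: (m x).
  by rewrite /O xS (subsetP sSW x xS) => xR; rewrite (disjointFl dWR).
apply/eqP/setP => v; rewrite inE; move: (m v); rewrite /O.
case: (boolP (v \in W)) => /= vW; case: (boolP (v \in S)) => // vS.
  by move=> fW; rewrite (disjointFr dWR).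
by rewrite (subsetP sSW v vS) in vW.
Qed.

End Forests.

Lemma sum_subset_card (T : finType) (W : {set T}) (F : nat -> nat) :
  \sum_(S : {set T} | S \subset W) F #|S| =
  \sum_(i < #|W|.+1) 'C(#|W|, i) * F i.
Proof.
rewrite (partition_big (fun S : {set T} => inord #|S| : 'I_(#|W|.+1)) xpredT) //=.
apply: eq_bigr => i _.
rewrite -cards_draws -sum_nat_const; apply: eq_big => [S | S /andP[sS /eqP <-]].
  rewrite !inE; case: (boolP (S \subset W)) => //= sS.
  by rewrite -val_eqE /= inordK // ltnS subset_leq_card.
by rewrite inordK // ltnS subset_leq_card.
Qed.

(** The absorption identity [i C(w, i) = w C(w - 1, i - 1)] turns the sum into [r] times the
    binomial expansion of [(w + r)^(w - 1)]. *)
Lemma forest_count_rec (w r : nat) : 0 < w ->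
  \sum_(i < w.+1) 'C(w, i) * (r ^ i * forest_count (w - i) i) = forest_count w r.
Proof.
case: w => // w _; rewrite big_ord_recl /= subn0 /forest_count /= mul0n !muln0 ?add0n.
rewrite -[w.+1 + r]/(addn w.+1 r) expnDn big_distrr /=. apply: eq_bigr => i _.
rewrite /bump leq0n add1n subSS expnS.
(* The top term is treated apart: there [forest_count] takes its conventional value 1. *)
have [-> | lt_iw] : i = w :> nat \/ i < w.
  by have := ltn_ord i; rewrite ltnS leq_eqVlt => /orP[/eqP|]; auto.
  by rewrite subnn eqxx !binn expn0; lia.
rewrite subn_eq0 leqNgt lt_iw /=.
have -> : w - i + i.+1 = w.+1 by lia.
have -> : w.+1 ^ (w - i) = w.+1 * w.+1 ^ (w - i).-1 by rewrite -expnS prednK ?subn_gt0.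
have e := mul_bin_diag w.+1 i.
transitivity (i.+1 * 'C(w.+1, i.+1) * (r * r ^ i * w.+1 ^ (w - i).-1)); first by ring.
by rewrite -e /=; ring.
Qed.

Lemma card_forests (T : finType) (W R : {set T}) : [disjoint W & R] ->
  #|forests W R| = forest_count #|W| #|R|.
Proof.
have [N] := ubnP #|W|; elim: N W R => // N IH W R ltN dWR.
have [W0 | W_gt0] := posnP #|W|.
  rewrite W0 (cards0_eq W0) /forest_count /= /forests.
  transitivity #|maps (@set0 T) (fun=> set0 :|: R)|.
    apply: eq_card => f; rewrite in_set andb_idr // => _.
    by apply/acycP => X; rewrite subset0 => /eqP.
  by rewrite card_maps big_set0.
rewrite card_forests_by_children // -forest_count_rec //.
rewrite -(sum_subset_card W (fun i => #|R| ^ i * forest_count (#|W| - i) i)).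
apply: eq_bigr => S sSW; congr (_ * _).
(* For empty [S] the set [W :\: S] does not shrink and induction does not apply; both sides are then
   0, as a nonempty forest needs a root. *)
have [S0 | S_gt0] := posnP #|S|.
  rewrite (cards0_eq S0) cards0 setD0 forests_no_root -?cards_eq0 -?lt0n // cards0.
  by rewrite subn0 /forest_count; case: #|W| W_gt0.
have cD : #|W :\: S| = #|W| - #|S| by rewrite cardsD (setIidPr sSW).
rewrite IH; last by rewrite disjoint_sym disjointDr.
  by rewrite cD.
by rewrite cD; lia.
Qed.

(** * Trees and parent maps *)

Section ParentMaps.
Variable V : finType.
Implicit Types (f g : V -> V) (r : V) (E : {set {set V}}).

Definition parent_map f r : bool := (f r == r) && acyc [set~ r] f.

Definition parent_edges f r : {set {set V}} := [set [set v; f v] | v in [set~ r]].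

Lemma set2_eqP (x y a b : V) :
  [set x; y] = [set a; b] -> (x = a /\ y = b) \/ (x = b /\ y = a).
Proof.
move=> e; have: [&& x \in [set a; b], y \in [set a; b],
    a \in [set x; y] & b \in [set x; y]].
  by rewrite -e set21 set22 e set21 set22.
rewrite !inE => /and4P[/pred2P[]h1 /pred2P[]h2 /pred2P[]h3 /pred2P[]h4]; subst; auto.
Qed.

Lemma parent_edgesP f r x y :
  reflect ((x != r /\ f x = y) \/ (y != r /\ f y = x)) (adj (parent_edges f r) x y).
Proof.
apply: (iffP imsetP) => [[v] | [[xr <-]|[yr <-]]].
- rewrite !inE => vr /set2_eqP[][-> ->]; auto.
- by exists x; rewrite ?inE.
- by exists y; rewrite ?inE // setUC.
Qed.

Lemma adj_sym E : symmetric (adj E).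
Proof. by move=> x y; rewrite /adj setUC. Qed.

Lemma parent_neq f r v : parent_map f r -> v != r -> f v != v.
Proof.
case/andP=> _ /acycP ac vr; apply/eqP => fv.
have /setP/(_ v) : [set v] = set0.
  apply: ac => [|x /set1P ->]; last by rewrite fv set11.
  by rewrite sub1set !inE.
by rewrite set11 inE.
Qed.

Lemma parent_neq2 f r v : parent_map f r -> v != r -> f v != r -> f (f v) != v.
Proof.
case/andP=> _ /acycP ac vr fr; apply/eqP => ffv.
have /setP/(_ v) : [set v; f v] = set0.
  apply: ac => [|x /set2P[] ->]; rewrite ?ffv ?set21 ?set22 //.
  by apply/subsetP => x /set2P[] ->; rewrite !inE.
by rewrite set21 inE.
Qed.

(** The points where [f] and [g] differ form an [f]-stable set: if [f v != g v], the edge from [v]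
    to [f v] must come from [g (f v) = v], whereas [f (f v) != v]. *)
Lemma parent_edges_inj f g r : parent_map f r -> parent_map g r ->
  parent_edges f r = parent_edges g r -> f =1 g.
Proof.
move=> pf pg eE.
have fr : f r = r by case/andP: pf => /eqP.
have gr : g r = r by case/andP: pg => /eqP.
suff X0 : [set v | f v != g v] = set0.
  by move=> v; move/setP/(_ v): X0; rewrite !inE => /negbT/negPn/eqP.
case/andP: (pf) => _ /acycP; apply => [|v].
  apply/subsetP => v; rewrite !inE; apply: contraNneq => ->.
  by rewrite fr gr.
rewrite !inE => fgv.
have vr : v != r by apply: contraNneq fgv => ->; rewrite fr gr.
have /parent_edgesP[] : adj (parent_edges g r) v (f v).
  by rewrite -eE; apply/parent_edgesP; left.
  by case=> _ gv; rewrite gv eqxx in fgv.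
by case=> fvr ->; apply: parent_neq2 pf vr fvr.
Qed.

(** The vertices not connected to [r] would form a stable set. *)
Lemma parent_edges_connect f r v : parent_map f r ->
  connect (adj (parent_edges f r)) v r.
Proof.
case/andP=> /eqP fr /acycP ac; set e := adj _.
suff /setP/(_ v) : [set x | ~~ connect e x r] = set0.
  by rewrite !inE => /negbT; rewrite negbK.
apply: ac => [|x].
  by apply/subsetP => x; rewrite !inE; apply: contraNneq => ->.
rewrite !inE => nx; apply: contra nx; apply: connect_trans.
have [-> | xr] := eqVneq x r; first by rewrite fr.
by apply: connect1; apply/parent_edgesP; left.
Qed.

Lemma parent_edges_connected f r : parent_map f r -> connected_graph (parent_edges f r).
Proof.
move=> pf; apply/forallP => x; apply/forallP => y.
apply: connect_trans (parent_edges_connect x pf) _.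
by rewrite (sym_connect_sym (@adj_sym _)) parent_edges_connect.
Qed.

(* Otherwise f would map X minus the root onto X, making X stable and rootless. *)
Lemma parent_leaf f r (X : {set V}) : parent_map f r -> X != set0 ->
  exists2 x, x \in X & forall y, y \in X -> y != r -> f y != x.
Proof.
case/andP=> /eqP fr /acycP ac X0.
have [/existsP[x /andP[xX /forallP hx]] | /existsPn h] :=
    boolP [exists x, (x \in X) && [forall y, (y \in X) && (y != r) ==> (f y != x)]].
  by exists x => // y yX yr; move: (hx y); rewrite yX yr.
have sX : X \subset f @: (X :\ r).
  apply/subsetP => x xX; move: (h x); rewrite xX /= => /forallPn[y].
  rewrite negb_imply negbK => /andP[/andP[yX yr] /eqP <-].
  by apply: imset_f; rewrite !inE yr.
have le1 := leq_trans (subset_leq_card sX) (leq_imset_card f _).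
have rX : r \notin X.
  by move: le1; rewrite (cardsD1 r X); case: (r \in X) => //; rewrite ltnn.
have XE : X :\ r = X.
  apply/setP => x; rewrite !inE andb_idl // => xX.
  by apply: contraNneq rX => <-.
rewrite XE in sX.
have fX : f @: X = X by apply/esym/eqP; rewrite eqEcard sX leq_imset_card.
case/eqP: X0; apply: ac => [|x xX]; last by rewrite -fX imset_f.
by rewrite -XE; apply/subsetP => x; rewrite !inE => /andP[].
Qed.

(* In a leaf of the cycle (a vertex without child on it) both neighbours would
   have to be its parent. *)
Lemma parent_edges_acyclic f r : parent_map f r -> acyclic_graph (parent_edges f r).
Proof.
move=> pf; apply/existsPn => -[s /= _]; apply/negP => /and3P[s_gt2 us cs].
have [x xs hx] : exists2 x, x \in [set x in s] &
    forall y, y \in [set x in s] -> y != r -> f y != x.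
  apply: parent_leaf pf _; apply/set0Pn.
  by case: s s_gt2 {us cs} => // x s _; exists x; rewrite !inE eqxx.
rewrite inE in xs.
have par y : y \in s -> adj (parent_edges f r) x y -> y = f x.
  move=> ys /parent_edgesP[[_ ->] // | [yr fy]].
  by move: (hx y); rewrite inE fy eqxx => /(_ ys yr).
have [i p sE] := rot_to xs.
have sz : size (x :: p) = size s by rewrite -sE size_rot.
have up : uniq (x :: p) by rewrite -sE rot_uniq.
have cp : cycle (adj (parent_edges f r)) (x :: p) by rewrite -sE rot_cycle.
have mp y : y \in p -> y \in s by move=> yp; rewrite -(mem_rot i) sE inE yp orbT.
rewrite -sz in s_gt2.
case: p s_gt2 up cp mp {sE sz} => // y p; case/lastP: p => // p z _ /= up.
rewrite rcons_path last_rcons => /and3P[xy _ zx] mp.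
have := par y (mp y (mem_head _ _)) xy.
rewrite -(par z) ?mp ?inE ?mem_rcons ?mem_head ?orbT // 1?adj_sym // => yz.
by move: up; rewrite yz mem_rcons mem_head andbF.
Qed.

Lemma parent_edges_tree f r : parent_map f r -> is_tree (parent_edges f r).
Proof.
move=> pf; apply/and3P; split; last exact: parent_edges_acyclic pf.
  apply/forallP => e; apply/implyP => /imsetP[v]; rewrite !inE => vr ->.
  by rewrite cards2 [v == _]eq_sym (parent_neq pf vr).
exact: parent_edges_connected pf.
Qed.

(** Breadth-first search from [r], with [d] the distance to [r]. In a stable set of non-root
    vertices, one nearest to [r] would have a parent nearer still. *)
Lemma connected_parent_map E r : connected_graph E ->
  exists f : {ffun V -> V}, parent_map f r /\ parent_edges f r \subset E.
Proof.
move=> cE.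
pose reach v n := [exists p : n.-tuple V, path (adj E) v p && (last v p == r)].
have ex v : exists n, reach v n.
  have /forallP/(_ v)/forallP/(_ r)/connectP[p ep lp] := cE.
  by exists (size p); apply/existsP; exists (in_tuple p); rewrite ep -lp eqxx.
pose d v := ex_minn (ex v).
have d0 : d r = 0.
  rewrite /d; case: ex_minnP => m _ /(_ 0) h; apply/eqP; rewrite -leqn0; apply: h.
  by apply/existsP; exists [tuple]; rewrite /= eqxx.
have dlt v : v != r -> exists2 w, adj E v w & d w < d v.
  move=> vr; rewrite {2}/d; case: ex_minnP => m /existsP[p /andP[ep lp]] _.
  case: m p ep lp => [p | m p]; first by rewrite tuple0 /= (negPf vr).
  rewrite (tuple_eta p) /= => /andP[vw ew] lw; exists (thead p) => //.
  rewrite ltnS /d; case: ex_minnP => k _; apply; apply/existsP.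
  by exists (behead_tuple p); rewrite ew.
(* The parent of a vertex is a neighbour at smaller distance from the root. *)
pose f := [ffun v => odflt v [pick w | adj E v w && (d w < d v)]].
have fr : f r = r by rewrite ffunE; case: pickP => //= w; rewrite d0 ltn0 andbF.
have fP v : v != r -> adj E v (f v) && (d (f v) < d v).
  move=> /dlt[w vw dw]; rewrite ffunE; case: pickP => //= /(_ w).
  by rewrite vw dw.
exists f; split; last first.
  by apply/subsetP => _ /imsetP[v + ->]; rewrite !inE => /fP/andP[].
rewrite /parent_map fr eqxx; apply/acycP => X sX cl.
apply/eqP/negPn/negP => /set0Pn[x0 x0X].
case: (arg_minnP d x0X) => x xX xmin.
have /andP[_] : adj E x (f x) && (d (f x) < d x).
  by apply: fP; have := subsetP sX x xX; rewrite !inE.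
by rewrite ltnNge => /negP; apply; apply: xmin; apply: cl.
Qed.

(** An edge of [E] outside [E'] would close a simple path of [E'] between its ends into a cycle of
    [E]. *)
Lemma tree_connected_sub E E' :
  is_tree E -> E' \subset E -> connected_graph E' -> E' = E.
Proof.
move=> /and3P[/forallP sE _ aE] sub cE; apply/eqP; rewrite eqEsubset sub /=.
apply/subsetP => e eE; apply: contraNT aE => eE'.
have /cards2P[x [y [xy ee]]] : #|e| == 2 by move: (sE e); rewrite eE.
have /forallP/(_ x)/forallP/(_ y)/connectP[p0 ep0] := cE.
case/shortenP: ep0 => p ep up _ yE.
have sp : size (x :: p) <= #|V| by rewrite -(card_uniqP up) max_card.
apply/existsP; exists (Bseq sp); rewrite up /=; apply/andP; split.
  (* The cycle has at least three vertices: an empty [p] forces [x = y], and a single step would put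
     [e] in [E']. *)
  case: p ep yE {up sp} => [|z [|]] //=; first by move=> _ yx; rewrite yx eqxx in xy.
  by rewrite andbT => xz yz; case/negP: eE'; rewrite ee yz.
rewrite rcons_path -yE adj_sym /adj -ee eE andbT.
by apply: sub_path ep => a b; apply: (subsetP sub).
Qed.

Lemma tree_parent_map E r : is_tree E ->
  exists2 f : {ffun V -> V}, parent_map f r & parent_edges f r = E.
Proof.
move=> tE; have /and3P[_ cE _] := tE.
have [f [pf sub]] := connected_parent_map r cE.
by exists f => //; apply: tree_connected_sub (parent_edges_connected pf).
Qed.

(** A simple path that does not visit the parent of its start only descends: after a step to a
    child, that child's parent has already been visited. *)
Lemma parent_edges_path f r x p : f x \notin p -> uniq (x :: p) ->
  path (adj (parent_edges f r)) x p -> path (fun u v => f v == u) x p.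
Proof.
elim: p x => //= y p IH x; rewrite inE negb_or => /andP[fxy fxp].
case/and3P=> xyp yp up /andP[/parent_edgesP xy ep].
have fy : f y = x by case: xy => [] [_] // fx; rewrite fx eqxx in fxy.
rewrite fy eqxx /=; apply: IH => //; rewrite ?fy ?yp //.
by move: xyp; rewrite inE negb_or => /andP[].
Qed.

Lemma path_parent_edges f r x p : r \notin p ->
  path (fun u v => f v == u) x p -> path (adj (parent_edges f r)) x p.
Proof.
elim: p x => //= y p IH x; rewrite inE negb_or eq_sym => /andP[yr rp] /andP[/eqP fy fp].
by rewrite IH // andbT; apply/parent_edgesP; right.
Qed.

End ParentMaps.

(** * Partitions and block minima *)

Section Stirling.
Variable a : nat.
Implicit Types (g : {ffun 'I_a -> 'I_a}) (D : {set 'I_a}).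

Definition lower D (v : 'I_a) : {set 'I_a} := [set d in D | d < v].
Definition upper D (v : 'I_a) : {set 'I_a} := [set d in D | v < d].

Definition min_maps (b : nat) : {set {ffun 'I_a -> 'I_a}} :=
  [set g : {ffun 'I_a -> 'I_a} | [forall v, (g (g v) == g v) && (g v <= v)]
     & #|[set v | g v == v]| == b].

(** For fixed point set [D], each point off [D] independently chooses a smaller element of [D];
    idempotence is then automatic. *)
Lemma card_min_maps b :
  #|min_maps b| = \sum_(D : {set 'I_a} | #|D| == b) \prod_(v in ~: D) #|lower D v|.
Proof.
rewrite -sum1_card.
rewrite (partition_big (fun g => [set v | g v == v])
  (fun D => #|D| == b)) /=; last first.
  by move=> g; rewrite inE => /andP[].
apply: eq_bigr => D cD; rewrite sum1_card -card_maps.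
apply: eq_card => g; rewrite unfold_in; apply/andP/mapsP.
  case; rewrite inE => /andP[/forallP h _] /eqP/setP fD v.
  have vD := fD v; rewrite inE in vD; rewrite in_setC -vD.
  case: eqP => [-> | /eqP gv] /=; first by rewrite set11.
  have /andP[/eqP gg gle] := h v.
  by rewrite inE -fD inE gg eqxx ltn_neqAle gle andbT.
move=> m.
have fD : [set v | g v == v] = D.
  apply/setP => v; rewrite inE; move: (m v); rewrite in_setC.
  case: (boolP (v \in D)) => /= vD; first by move/set1P->; rewrite eqxx.
  by rewrite inE => /andP[_ lt]; apply: contraTF lt => /eqP ->; rewrite ltnn.
split; last by rewrite fD.
rewrite inE fD cD andbT; apply/forallP => v.
move: (m v); rewrite in_setC; case: (boolP (v \in D)) => /= vD.
  by move/set1P => gv; rewrite gv gv eqxx leqnn.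
rewrite inE => /andP[gD /ltnW ->]; move: (m (g v)).
by rewrite in_setC gD /= => /set1P ->; rewrite eqxx.
Qed.

(* A partition is encoded by the map sending a point to the minimum of its
   block; the blocks are the fibres of this map and its fixed points are the
   minima. *)
Lemma stirling2_min_maps b : stirling2 a b = #|min_maps b|.
Proof.
pose fib g := preim_partition g [set: 'I_a].
pose cls g v := [set w | g v == g w].
have fibE g : fib g = cls g @: [set: 'I_a].
  by apply: eq_imset => v; apply/setP => w; rewrite !inE.
have card_fib g : (forall v, g (g v) = g v) -> #|fib g| = #|[set v | g v == v]|.
  move=> gg; rewrite fibE.
  have -> : cls g @: [set: 'I_a] = cls g @: [set v | g v == v].
    apply/setP => B; apply/imsetP/imsetP => [[v _ ->]|[v _ ->]]; last by exists v.
    by exists (g v); rewrite ?inE ?gg //; apply/setP => w; rewrite !inE gg.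
  rewrite card_in_imset // => v w; rewrite !inE => /eqP gv /eqP gw /setP/(_ w).
  by rewrite !inE eqxx gv gw => /eqP.
have same g v w : (g v == g w) = (w \in pblock (fib g) v).
  by rewrite pblock_equivalence_partition ?inE //; split=> // /eqP ->.
rewrite -(card_in_imset (f := fib)); last first.
  move=> f g; rewrite !inE => /andP[/forallP hf _] /andP[/forallP hg _] efg.
  apply/ffunP => v; apply/val_inj/eqP; rewrite /= eqn_leq.
  have [/andP[/eqP ff _] /andP[/eqP gg _]] := (hf v, hg v).
  (* [v] and [g v] share a fibre of [g], hence of [f], so [f v = f (g v) <= g v]; the other
     inequality is symmetric. *)
  have e1 : f v = f (g v) by apply/eqP; rewrite same efg -same gg.
  have e2 : g v = g (f v) by apply/eqP; rewrite same -efg -same ff.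
  apply/andP; split.
    by rewrite e1; case/andP: (hf (g v)).
  by rewrite e2; case/andP: (hg (f v)).
apply: eq_card => P; rewrite inE; apply/andP/imsetP; last first.
  case=> g; rewrite inE => /andP[/forallP hg /eqP cg] ->; split.
    exact: preim_partitionP.
  by rewrite card_fib ?cg // => v; case/andP: (hg v) => /eqP.
case=> pP cP.
have [/eqP cov tiP _] := and3P pP.
have vP v : v \in pblock P v by rewrite mem_pblock cov inE.
pose g : {ffun 'I_a -> 'I_a} := [ffun v => [arg min_(w < v in pblock P v) w]].
have gP v : g v \in pblock P v /\ forall w, w \in pblock P v -> g v <= w.
  by rewrite ffunE; case: arg_minnP.
have pb v : pblock P (g v) = pblock P v by apply: same_pblock; last exact: (gP v).1.
have eqg v w : (g v == g w) = (pblock P v == pblock P w).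
  apply/eqP/eqP => [e | e]; first by rewrite -pb e pb.
  apply/val_inj/eqP; rewrite /= eqn_leq; have [[gv gvm] [gw gwm]] := (gP v, gP w).
  by rewrite gvm ?gwm // ?e // -e.
have fg : fib g = P.
  rewrite -[RHS](preim_partition_pblock pP); apply: eq_imset => v.
  by apply/setP => w; rewrite !inE eqg.
have gg v : g (g v) = g v by apply/eqP; rewrite eqg pb.
exists g => //; rewrite inE -card_fib // fg cP andbT; apply/forallP => v.
by rewrite gg eqxx; apply: (gP v).2.
Qed.

End Stirling.

Lemma enum_val_lt N (A : {set 'I_N}) (i j : 'I_#|A|) :
  (enum_val i < enum_val j) = (i < j).
Proof.
have srt : sorted (fun x y : 'I_N => x < y) (enum A).
  rewrite /enum_mem; apply: sorted_filter; first by move=> x y z; apply: ltn_trans.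
  by rewrite -enumT; have := iota_ltn_sorted 0 N; rewrite -val_enum_ord sorted_map.
have mono (k l : 'I_#|A|) : k < l -> enum_val k < enum_val l.
  move=> kl; rewrite (enum_val_nth (enum_val i) k) (enum_val_nth (enum_val i) l).
  apply: (sorted_ltn_nth _ _ srt) => //; rewrite ?inE -?cardE //.
  by move=> x y z; apply: ltn_trans.
apply/idP/idP; last exact: mono.
apply: contraTT; rewrite -!leqNgt leq_eqVlt => /orP[/eqP/val_inj -> //|/mono/ltnW //].
Qed.

(** [enum_val] is an order isomorphism from ['I_#|A|] onto [A], so it carries the sum of
    [card_min_maps] to subsets of [A]. *)
Lemma sum_lower_stirling2 N (A : {set 'I_N}) (b : nat) :
  \sum_(D : {set 'I_N} | (D \subset A) && (#|D| == b))
    \prod_(v in A :\: D) #|lower D v| =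
  stirling2 #|A| b.
Proof.
rewrite stirling2_min_maps card_min_maps.
pose h : 'I_#|A| -> 'I_N := enum_val.
pose imh (D : {set 'I_#|A|}) := h @: D.
have injh : injective h by apply: enum_val_inj.
have hA (D : {set 'I_N}) : (D \subset A) = (D \in imh @: setT).
  apply/idP/imsetP => [sD | [D' _ ->]].
    exists (h @^-1: D) => //; apply/setP => x; apply/idP/imsetP => [xD | [y + ->]].
      exists (enum_rank_in (subsetP sD x xD) x); last first.
        by rewrite /h enum_rankK_in // (subsetP sD).
      by rewrite inE /h enum_rankK_in // (subsetP sD).
    by rewrite inE.
  by apply/subsetP => _ /imsetP[y _ ->]; apply: enum_valP.
rewrite (eq_bigl (fun D => (D \in imh @: setT) && (#|D| == b)));
  last by move=> D; rewrite hA.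
rewrite big_imset_cond /=; last by move=> D1 D2 _ _; apply: imset_inj.
apply: eq_big => [D | D _]; first by rewrite in_setT card_imset.
have -> : A :\: h @: D = h @: ~: D.
  apply/setP => x; rewrite in_setD; apply/andP/imsetP => [[xD xA] | [y + ->]].
    have e : h (enum_rank_in xA x) = x by rewrite /h enum_rankK_in.
    exists (enum_rank_in xA x) => //; rewrite inE; apply: contra xD => ?.
    by rewrite -e imset_f.
  by rewrite inE mem_imset // => ->; split=> //; apply: enum_valP.
rewrite big_imset /=; last by move=> x y _ _; apply: injh.
apply: eq_bigr => v _; rewrite -(card_imset _ injh); apply: eq_card => x.
rewrite inE; apply/andP/imsetP => [[/imsetP[y yD ->]] | [y + ->]].
  by rewrite enum_val_lt => yv; exists y; rewrite // inE yD.
by rewrite inE => /andP[yD yv]; rewrite imset_f // enum_val_lt.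
Qed.

(** * The maximal decreasing subtree *)

Lemma upper_ord_max N (D : {set 'I_N}) :
  D != set0 -> exists2 y, y \in D & upper D y = set0.
Proof.
case/set0Pn=> x xD; case: (@arg_maxnP _ x (mem D) val xD) => y yD ymax.
exists y => //; apply/setP => d; rewrite !inE; apply/andP => -[/ymax le].
by rewrite ltnNge => /negP; apply.
Qed.

(** Counts decreasing trees on [D], by induction on its size: the minimum [x] is a leaf with
    [#|D| - 1] possible parents, and deleting it leaves the other sets [upper D v] unchanged. *)
Lemma sum_prod_upper N (D : {set 'I_N}) : D != set0 ->
  \sum_(r in D) \prod_(v in D :\ r) #|upper D v| = (#|D|.-1)`!.
Proof.
have [c] := ubnP #|D|; elim: c D => // c IH D ltc D0.
have [x xD xmin] : exists2 x, x \in D & forall y, y \in D -> x <= y.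
  case/set0Pn: (D0) => x0 x0D; case: (@arg_minnP _ x0 (mem D) val x0D) => x xD xmin.
  by exists x.
have cD : #|D| = #|D :\ x|.+1 by rewrite (cardsD1 x) xD.
rewrite (big_setD1 x) //=.
have [D'0 | D'0] := eqVneq (D :\ x) set0.
  by rewrite cD D'0 !big_set0 cards0.
have [y yD' uy] := upper_ord_max D'0.
have xlt z : z \in D :\ x -> x < z.
  by rewrite !inE => /andP[zx zD]; rewrite ltn_neqAle xmin // andbT eq_sym.
have uE z : z \in D :\ x -> upper D z = upper (D :\ x) z.
  move=> /xlt xz; apply/setP => d; rewrite !inE; case: eqP => [-> | _] //=.
  by rewrite (leq_gtF (ltnW xz)) andbF.
(* The term with root [x] vanishes, because the maximum [y] has no larger element to choose as
   parent. *)
rewrite (big_setD1 y) //= uE // uy cards0 mul0n add0n.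
have ux : upper D x = D :\ x.
  apply/setP => d; rewrite !inE; case: (eqVneq d x) => [-> | dx] /=.
    by rewrite ltnn andbF.
  by rewrite andb_idr // => dD; rewrite xlt // !inE dx.
transitivity (\sum_(r in D :\ x) #|D :\ x| *
    \prod_(v in D :\ x :\ r) #|upper (D :\ x) v|).
  apply: eq_bigr => r rD'; rewrite (big_setD1 x); last first.
    by rewrite !inE xD andbT eq_sym; move: rD'; rewrite !inE => /andP[].
  rewrite ux; congr (_ * _); rewrite !setDDl setUC; apply: eq_bigr => v.
  by rewrite !inE negb_or => /andP[/andP[vx vr] vD]; rewrite uE // !inE vx.
rewrite -big_distrr /= IH //; last by rewrite -ltnS -cD.
move: D'0; rewrite cD /= -cards_eq0; by case: #|D :\ x| => // m _; rewrite factS.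
Qed.

Section MaximalDecreasing.
Variable n : nat.
Implicit Types (f : {ffun 'I_n.+1 -> 'I_n.+1}) (r v : 'I_n.+1) (A D : {set 'I_n.+1}).

(** A local description of the maximal decreasing subtree by parent links, replacing paths. *)
Definition MD_spec (f : 'I_n.+1 -> 'I_n.+1) r D :=
  forall v, (v \in D) = (v == r) || (f v \in D) && (v < f v).

(** Membership of a non-root [v] is decided by that of [f v], so the points where [D] and [D']
    disagree form a stable set. *)
Lemma MD_spec_inj (f : 'I_n.+1 -> 'I_n.+1) r D D' :
  parent_map f r -> MD_spec f r D -> MD_spec f r D' -> D = D'.
Proof.
case/andP=> _ /acycP ac sD sD'.
suff X0 : [set v | (v \in D) != (v \in D')] = set0.
  by apply/setP => v; move/setP/(_ v): X0; rewrite !inE => /negbT/negPn/eqP.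
apply: ac => [|v]; rewrite ?inE.
  by apply/subsetP => v; rewrite !inE; apply: contraNneq => ->; rewrite sD sD' eqxx.
by rewrite sD sD'; apply: contraNneq => ->.
Qed.

Lemma MD_specP (f : 'I_n.+1 -> 'I_n.+1) r :
  parent_map f r -> MD_spec f r (MD (parent_edges f r, r)).
Proof.
move=> pf; have fr : f r = r by case/andP: pf => /eqP.
pose e (x y : 'I_n.+1) := (f y == x) && (y < x).
suff mdP v : reflect (exists2 p, path e r p & last r p = v)
    (v \in MD (parent_edges f r, r)).
  move=> v; apply/mdP/orP => [[p] | [/eqP -> | /andP[/mdP[p ep lp] lt]]].
  - case/lastP: p => [_ <- | p w]; first by left.
    rewrite rcons_path last_rcons => /andP[ep /andP[/eqP fw lt]] wv; right.
    by rewrite -wv fw lt andbT; apply/mdP; exists p.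
  - by exists [::].
  - by exists (rcons p v); rewrite ?last_rcons // rcons_path ep /e lp eqxx lt.
have pathE p : path e r p = path (fun u v => f v == u) r p &&
    path (fun u v : 'I_n.+1 => v < u) r p by rewrite -path_relI.
rewrite inE; apply: (iffP existsP) => [[p] | [p ep lp]] /=.
  case/andP=> /and3P[/= ap up /eqP lp] dp; exists p => //.
  rewrite pathE dp andbT; apply: (parent_edges_path _ up ap).
  by rewrite fr; case/andP: up.
have /andP[fp dp] := etrans (esym (pathE p)) ep.
(* Strictly decreasing labels never repeat, which also bounds the length of [p] by [n]. *)
have up : uniq (r :: p).
  apply: (@sorted_uniq _ (fun u v : 'I_n.+1 => v < u) _ _ (r :: p) dp).
    by move=> x y z /= xy yz; apply: ltn_trans xy.
  by move=> x; rewrite /= ltnn.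
have sp : size p <= n.
  by have := max_card [in r :: p]; rewrite card_ord (card_uniqP up) ltnS.
exists (Bseq sp); rewrite /simple_path /= dp lp eqxx !andbT; apply/andP; split=> //.
by apply: path_parent_edges fp; case/andP: up.
Qed.

(** Admissible parents. The points of [A :\: D] are the children of [D] across increasing edges;
    they root the forest that hangs below [D]. *)
Definition tree_maps A D r : 'I_n.+1 -> {set 'I_n.+1} := fun v =>
  if v \in D then upper D v else if v \in A then lower D v else ~: D.

(** A non-root vertex with parent in [D] lies in [D] exactly when its label is below its parent's.
    This turns the global conditions on [f] into pointwise ones, with acyclicity needed only off
    [A]. *)
Lemma parent_map_fiber A D r f :
  [&& parent_map f r, MD (parent_edges f r, r) == D & f @^-1: D == A] =
  [&& D \subset A, r \in D &
    f \in [set f in maps [set~ r] (tree_maps A D r) | acyc (~: A) f]].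
Proof.
apply/and3P/and3P => [[pf /eqP mD /eqP AE] | [sDA rD]].
  have sD : MD_spec f r D by rewrite -mD; apply: MD_specP.
  have /andP[/eqP fr ac] := pf.
  have rD : r \in D by rewrite sD eqxx.
  have inA v : (v \in A) = (f v \in D) by rewrite -AE inE.
  have sDA : D \subset A.
    apply/subsetP => v; rewrite inA [v \in D]sD; case: eqP => [-> | _ /andP[] //].
    by rewrite fr.
  split=> //; rewrite inE; apply/andP; split; last first.
    apply: acycS ac; apply/subsetP => v; rewrite !inE; apply: contraNneq => ->.
    exact: (subsetP sDA).
  apply/mapsP => v; rewrite in_setC1; have [-> | vr] /= := eqVneq v r.
    by rewrite fr set11.
  rewrite /tree_maps inA sD (negPf vr) /=; case: (boolP (f v \in D)) => fD /=.
    case: ltngtP => fv; rewrite !inE fD ?fv //.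
    by have := parent_neq pf vr; rewrite -(val_inj fv) eqxx.
  by rewrite inE.
rewrite inE => /andP[/mapsP m ac].
have fr : f r = r by move: (m r); rewrite in_setC1 eqxx /= => /set1P.
have mv v : v != r -> f v \in tree_maps A D r v.
  by move=> vr; move: (m v); rewrite in_setC1 vr.
have fin v : (v \in A) = (f v \in D).
  have [-> | /mv] := eqVneq v r; first by rewrite fr rD (subsetP sDA).
  rewrite /tree_maps; case: (boolP (v \in D)) => vD.
    by rewrite (subsetP sDA) // inE => /andP[->].
  by case: (boolP (v \in A)) => vA; rewrite !inE; [case/andP=> -> | move/negPf->].
have up v : v != r -> v \in D -> v < f v.
  by move=> /mv; rewrite /tree_maps => + vD; rewrite vD inE => /andP[].
have down v : v \notin D -> v \in A -> f v < v.
  move=> vD vA; have /mv : v != r by apply: contraNneq vD => ->.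
  by rewrite /tree_maps (negPf vD) vA inE => /andP[].
have sD : MD_spec f r D.
  move=> v; rewrite -fin; have [-> // | vr] /= := eqVneq v r.
  case: (boolP (v \in D)) => vD; first by rewrite (subsetP sDA) // up.
  by case: (boolP (v \in A)) => //= vA; rewrite ltnNge ltnW // down.
have pf : parent_map f r.
  rewrite /parent_map fr eqxx /=; apply/acycP => X sX cl.
  have Xr x : x \in X -> x != r by move/(subsetP sX); rewrite !inE.
  (* The largest element of [X :&: D] would have a larger parent in [X :&: D]. So [X] avoids [D],
     hence also [A], whose points have their parents in [D]. *)
  have XD : X :&: D = set0.
    apply/eqP/negPn/negP => /set0Pn[x0 x0X].
    case: (@arg_maxnP _ x0 (mem (X :&: D)) val x0X) => x /setIP[xX xD] xmax.
    have /= : f x <= x.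
      by apply: xmax; apply/setIP; rewrite cl // -fin (subsetP sDA).
    by rewrite leqNgt up // Xr.
  move/acycP: ac; apply => //; apply/subsetP => x xX; rewrite inE fin.
  by apply/negP => fxD; move/setP/(_ (f x)): XD; rewrite in_setI cl // fxD inE.
split=> //; first by apply/eqP; apply: MD_spec_inj pf (MD_specP pf) sD.
by apply/eqP/setP => v; rewrite inE fin.
Qed.

(** Off [A] the admissible parents form [~: D], the union of [~: A] and [A :\: D], which gives
    forests on [~: A] with root set [A :\: D]. *)
Lemma card_tree_maps A D r : D \subset A -> r \in D ->
  #|[set f in maps [set~ r] (tree_maps A D r) | acyc (~: A) f]| =
  \prod_(v in D :\ r) #|upper D v| * \prod_(v in A :\: D) #|lower D v| *
  forest_count #|~: A| #|A :\: D|.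
Proof.
move=> sDA rD; have rA := subsetP sDA r rD.
have -> : [set~ r] = A :\ r :|: ~: A.
  by apply/setP => v; rewrite !inE; case: eqP => [->|] /=; rewrite ?rA ?orbN.
rewrite card_maps_acyc; last first.
  by apply/pred0P => v /=; rewrite !inE; case: (v \in A); rewrite ?andbF.
congr (_ * _); last first.
  rewrite -card_forests; last first.
    by apply/pred0P => v /=; rewrite !inE; case: (v \in A); rewrite ?andbF.
  apply: eq_card => f; rewrite !in_set; congr andb; apply: eq_forallb => v.
  rewrite in_setC /tree_maps; case: (boolP (v \in A)) => //= vA.
  rewrite (negPf (contra (subsetP sDA v) vA)); suff -> : ~: A :|: A :\: D = ~: D by [].
  apply/setP => x; rewrite !inE.
  by case: (boolP (x \in D)) => [/(subsetP sDA) ->|]; rewrite ?orNb.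
rewrite (big_setID D) /=; congr (_ * _); apply: eq_big => v.
- by rewrite !inE; case: (boolP (v \in D)) => [/(subsetP sDA) ->|];
    rewrite ?andbT ?andbF.
- by rewrite /tree_maps !inE => /andP[_ ->].
- by rewrite !inE; case: (eqVneq v r) => [->|] //=; rewrite rD.
- by rewrite /tree_maps !inE => /and3P[/negPf -> _ ->].
Qed.

Lemma card_rooted_trees_MD k :
  #|rooted_trees_MD n k| =
  #|[set p : {ffun 'I_n.+1 -> 'I_n.+1} * 'I_n.+1 |
      parent_map p.1 p.2 & #|MD (parent_edges p.1 p.2, p.2)| == k.+1]|.
Proof.
pose Phi (p : {ffun 'I_n.+1 -> 'I_n.+1} * 'I_n.+1) := (parent_edges p.1 p.2, p.2).
rewrite -[RHS](card_in_imset (f := Phi)); last first.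
  move=> [f r] [g s]; rewrite !inE /= => /andP[pf _] /andP[pg _] [efg rs].
  subst s; congr pair; apply/ffunP; exact: parent_edges_inj pf pg efg.
apply: eq_card => -[E r]; rewrite !inE; apply/andP/imsetP => /=.
  case=> tE cE; have [f pf Ef] := tree_parent_map r tE.
  by exists (f, r); rewrite ?inE /Phi /= Ef // pf.
case=> [[f s]]; rewrite inE /= => /andP[pf cE] [-> ->].
by split=> //; apply: parent_edges_tree pf.
Qed.

(** Pairs of a parent map and a root are sorted by the preimage [A] of the decreasing subtree, then
    by that subtree [D], then by the root. *)
Lemma card_rooted_trees_MD_sum k :
  #|rooted_trees_MD n k| =
  \sum_(A : {set 'I_n.+1}) \sum_(D : {set 'I_n.+1} | (D \subset A) && (#|D| == k.+1))
    \sum_(r in D)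
    #|[set f in maps [set~ r] (tree_maps A D r) | acyc (~: A) f]|.
Proof.
rewrite card_rooted_trees_MD -sum1_card.
pose md (p : {ffun 'I_n.+1 -> 'I_n.+1} * 'I_n.+1) := MD (parent_edges p.1 p.2, p.2).
rewrite (partition_big (fun p : {ffun 'I_n.+1 -> 'I_n.+1} * 'I_n.+1 =>
  p.1 @^-1: md p) xpredT) //=; apply: eq_bigr => A _.
rewrite (partition_big md (fun D => (D \subset A) && (#|D| == k.+1))) /=; last first.
  move=> [f r]; rewrite inE /= => /andP[/andP[pf ->] fA]; rewrite andbT.
  have := parent_map_fiber A (md (f, r)) r f.
  by rewrite pf eqxx fA => /esym/and3P[].
apply: eq_bigr => D /andP[sDA cD].
rewrite (partition_big snd (mem D)) /=; last first.
  move=> [f r]; rewrite inE /= => /andP[/andP[/andP[pf _] fA] mD].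
  have := parent_map_fiber A D r f.
  by rewrite pf mD -(eqP mD) fA => /esym/and3P[].
apply: eq_bigr => r rD.
have injr : injective (fun f : {ffun 'I_n.+1 -> 'I_n.+1} => (f, r)) by move=> f g [].
rewrite sum1_card -[RHS](card_imset _ injr).
apply: eq_card => -[f s]; rewrite unfold_in /= inE /=.
have [-> | sr] := eqVneq s r; last first.
  by rewrite andbF; apply/esym/imsetP => -[g _ [_ e]]; rewrite e eqxx in sr.
rewrite mem_imset; last by move=> g h [].
have := parent_map_fiber A D r f; rewrite sDA rD /= => <-; rewrite andbT /md /=.
by case: (eqVneq (MD _) D) => [-> | _]; rewrite ?cD ?andbT ?andbF.
Qed.

End MaximalDecreasing.

(** * Summation over the size of [A] *)

Lemma stirling2_small (a b : nat) : a < b -> stirling2 a b = 0.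
Proof.
move=> ab; rewrite -[a in LHS]card_ord -cardsT -sum_lower_stirling2 big_pred0 // => D.
apply/negP => /andP[sD /eqP cD]; move: (subset_leq_card sD).
by rewrite cD cardsT card_ord leqNgt ab.
Qed.

Theorem theorem2p1 (n k : nat) :
  #|rooted_trees_MD n k| =
  \sum_(k <= m < n.+1)
     'C(n.+1, m.+1) * stirling2 m.+1 k.+1 * k`! * forest_factor n k m.
Proof.
rewrite card_rooted_trees_MD_sum.
(* The contribution of one set [A] of size [i], already summed over [D] and the root. *)
pose F i := k`! * forest_count (n.+1 - i) (i - k.+1) * stirling2 i k.+1.
transitivity (\sum_(A : {set 'I_n.+1} | A \subset [set: 'I_n.+1]) F #|A|).
  apply: eq_big => A; first by rewrite subsetT.
  move=> _; rewrite /F -sum_lower_stirling2 big_distrr /=.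
  apply: eq_bigr => D /andP[sDA /eqP cD].
  under eq_bigr => r rD do rewrite (card_tree_maps sDA rD) -mulnA.
  rewrite -big_distrl /= sum_prod_upper -?cards_eq0 cD //=.
  rewrite cardsD (setIidPr sDA) cD [#|~: A|]cardsCs setCK card_ord.
  by rewrite -mulnA; congr (_ * _); rewrite mulnC.
(* The empty [A] contributes 0; the remaining sizes are [m + 1]. *)
rewrite sum_subset_card cardsT card_ord big_ord_recl /F stirling2_small // !muln0 add0n.
rewrite -(big_mkord xpredT (fun i => 'C(n.+1, i.+1) * F i.+1)) /=.
have [kn | nk] := leqP k n; last first.
  rewrite [RHS]big_geq // big_nat big1 // => i /andP[_ lt_in].
  by rewrite /F stirling2_small ?muln0 //; lia.
(* The terms with [m < k] vanish through their Stirling numbers. *)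
rewrite (big_cat_nat (n := k)) //=; last exact: leqW.
rewrite [X in X + _]big_nat big1 ?add0n; last first.
  by move=> i /andP[_ lt_ik]; rewrite /F stirling2_small ?muln0.
rewrite big_nat [RHS]big_nat; apply: eq_bigr => m /andP[km mn].
(* With [w = n - m] and [r = m - k], [w + r = n - k], and [w = 0] means [m = n], so the two
   conventions for value 1 agree. *)
rewrite /F /forest_count /forest_factor !subSS subn_eq0.
have -> : (n <= m) = (m == n) by lia.
have -> : n - m + (m - k) = n - k by lia.
rewrite subn1; case: eqP => _; ring.
Qed.
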